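(* Let $K$ be a field, $q_1,q_2,q_3\in K^\times$ and $a,b,c,\alpha,\beta,\gamma,\lambda,\mu,\nu,b_1,b_2,b_3\in K$. Let $A$ be the algebra generated over $K$ by elements $x_1,x_2,x_3$ subject to the defining relations $$x_2x_1-q_1x_1x_2=ax_1+bx_2+cx_3+b_1,$$ $$x_3x_1-q_2x_1x_3=\alpha x_1+\beta x_2+\gamma x_3+b_2,$$ $$x_3x_2-q_3x_2x_3=\lambda x_1+\mu x_2+\nu x_3+b_3.$$ Then the defining relations are consistent (i.e. $A\ne 0$) and $A=\bigoplus_{\alpha\in\mathbb{N}^3}Kx^\alpha$, where $x^\alpha=x_1^{\alpha_1}x_2^{\alpha_2}x_3^{\alpha_3}$, if and only if the following conditions hold: $$(1-q_3)\alpha=(1-q_2)\mu,$$ $$(1-q_3)a=(1-q_1)\nu,$$ $$(1-q_2)b=(1-q_1)\gamma,$$ $$(1-q_1q_2)\lambda=0,$$ $$(q_1-q_3)\beta=0,$$ $$(1-q_2q_3)c=0,$$ $$((1-q_3)\alpha-\mu)a+(b+q_1\gamma)\lambda-\nu\alpha+(q_1q_2-1)b_3=0,$$ $$(a-\nu)\beta+q_1\gamma\mu-q_3\alpha b+(q_1-q_3)b_2=0,$$ $$(a+(q_1-1)\nu)\gamma+b\nu-(\mu+q_3\alpha)c+(1-q_2q_3)b_1=0,$$ $$-(\mu+q_3\alpha)b_1+(a-\nu)b_2+(b+q_1\gamma)b_3=0.$$ Furthermore, if $A=\bigoplus_{\alpha\in\mathbb{N}^3}Kx^\alpha$ then $A=\bigoplus_{\alpha\in\mathbb{N}^3}Kx_\sigma^\alpha$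 for all $\sigma\in S_3$, where $x_\sigma^\alpha=x_{\sigma(1)}^{\alpha_1}x_{\sigma(2)}^{\alpha_2}x_{\sigma(3)}^{\alpha_3}$.
   Context: $K^\times=K\setminus\{0\}$. The symbol $\alpha$ is used both for a scalar coefficient in $K$ (in the relations and conditions) and for a multi-index $(\alpha_1,\alpha_2,\alpha_3)\in\mathbb{N}^3$ (in $x^\alpha$, $x_\sigma^\alpha$); these are unrelated. $A=\bigoplus_{\alpha}Kx^\alpha$ means that the monomials $x^\alpha$, $\alpha\in\mathbb{N}^3$ (with $\mathbb{N}\ni 0$), form a $K$-basis of $A$. *)

(* Defs.v *)
From HB Require Import structures.
From mathcomp Require Import all_boot all_algebra perm.
From mathcomp Require Import finmap.
From mathcomp.classical Require Import boolp.
From mathcomp.multinomials Require Import monalg.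

Set Implicit Arguments.
Unset Strict Implicit.
Unset Printing Implicit Defensive.

Import GRing.Theory.
Local Open Scope ring_scope.
Local Open Scope quotient_scope.

(* The free associative unital K-algebra on n generators: the monoid algebra
   of the free monoid on 'I_n. *)
Notation free_alg K n := {malg K[{fmonom 'I_n}]}.

HB.lock Definition free_var (K : fieldType) (n : nat) (i : 'I_n) : free_alg K n :=
  << fmu i >>.

Lemma free_scalerAr (K : fieldType) (n : nat) (k : K) (f g : free_alg K n) :
  k *: (f * g) = f * (k *: g).
Proof.
rewrite [in RHS](malgMEw (fsubset_refl _) (msuppZ_le k g)) malgME.
rewrite scaler_sumr; apply: eq_bigr => i _; rewrite scaler_sumr.
apply: eq_bigr => j _; apply/malgP => m.
by rewrite mcoeffZ !mcoeffU mcoeffZ mulrnAr mulrCA.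
Qed.

Definition two_sided_ideal (F : pzRingType) (J : F -> Prop) : Prop :=
  [/\ J 0, forall f g, J f -> J g -> J (f - g)
    & forall u f v, J f -> J (u * f * v)].

Definition ideal_gen (F : pzRingType) (S : seq F) : {pred F} :=
  fun f => `[< forall J : F -> Prop, two_sided_ideal J ->
                 (forall r, r \in S -> J r) -> J f >].

Section IdealGen.
Variables (F : pzRingType) (S : seq F).

Lemma ideal_gen_ideal : two_sided_ideal (fun f => f \in ideal_gen S).
Proof.
split=> [|f g /asboolP hf /asboolP hg|u f v /asboolP hf]; apply/asboolP=> J hJ SJ;
  case: (hJ) => J0 JB JM //.
- by apply: JB; [apply: hf | apply: hg].
- by apply: JM; apply: hf.
Qed.

Lemma ideal_gen_mem r : r \in S -> r \in ideal_gen S.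
Proof. by move=> rS; apply/asboolP=> J _; apply. Qed.

Lemma ideal_gen_zmod_closed : zmod_closed (ideal_gen S).
Proof. by case: ideal_gen_ideal. Qed.

HB.instance Definition _ :=
  GRing.isZmodClosed.Build F (ideal_gen S) ideal_gen_zmod_closed.

End IdealGen.

(* The K-algebra K<X_0, ..., X_(n-1)> / (rels).  This quotient may be the zero
   ring, whence a pzRingType and not an algType (which requires 1 != 0). *)
Definition pres_alg (K : fieldType) (n : nat) (rels : seq (free_alg K n)) :=
  Quotient.quot (ideal_gen rels).

HB.lock Definition pres_pi (K : fieldType) (n : nat) (rels : seq (free_alg K n))
    (f : free_alg K n) : pres_alg rels := \pi_(pres_alg rels) f.

(* Locked for performance: the operations of {malg} are costly to unfold. *)
HB.lock Definition pres_one (K : fieldType) (n : nat)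
    (rels : seq (free_alg K n)) : pres_alg rels := pres_pi rels 1.

HB.lock Definition pres_mul (K : fieldType) (n : nat)
    (rels : seq (free_alg K n)) (x y : pres_alg rels) : pres_alg rels :=
  pres_pi rels (repr x * repr y).

HB.lock Definition pres_scale (K : fieldType) (n : nat)
    (rels : seq (free_alg K n)) (k : K) (x : pres_alg rels) : pres_alg rels :=
  pres_pi rels (k *: repr x).

Section PresAlg.
Variables (K : fieldType) (n : nat) (rels : seq (free_alg K n)).
Local Notation F := (free_alg K n).
Local Notation A := (pres_alg rels).
Local Notation pres_pi := (pres_pi rels).
Local Notation pres_one := (pres_one rels).
Local Notation pres_mul := (@pres_mul K n rels).
Local Notation pres_scale := (@pres_scale K n rels).
Implicit Types (f g h : F) (k : K).

HB.instance Definition _ := GRing.Zmodule.on A.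
HB.instance Definition _ := EqQuotient.on A.

Lemma pres_piP f g : reflect (pres_pi f = pres_pi g) (f - g \in ideal_gen rels).
Proof. by rewrite Quotient.idealrBE unlock; apply: eqP. Qed.

Lemma pres_pi_is_zmod_morphism : zmod_morphism pres_pi.
Proof. by move=> f g; rewrite unlock !piE. Qed.

HB.instance Definition _ :=
  GRing.isZmodMorphism.Build F A pres_pi pres_pi_is_zmod_morphism.

Lemma pres_reprK (x : A) : pres_pi (repr x) = x.
Proof. by rewrite unlock reprK. Qed.

Lemma repr_pres f : repr (pres_pi f) - f \in ideal_gen rels.
Proof. by apply/pres_piP; rewrite pres_reprK. Qed.

Lemma pres_mulE f g : pres_mul (pres_pi f) (pres_pi g) = pres_pi (f * g).
Proof.
have [_ _ IM] := ideal_gen_ideal rels; rewrite pres_mul.unlock; apply/pres_piP.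
set u := repr _; set v := repr _.
have -> : u * v - f * g = (u - f) * v + f * (v - g).
  by rewrite mulrBl mulrBr addrA subrK.
apply: rpredD.
  by have := IM 1 _ v (repr_pres f); rewrite mul1r.
by have := IM f _ 1 (repr_pres g); rewrite mulr1.
Qed.

Lemma pres_scaleE k f : pres_scale k (pres_pi f) = pres_pi (k *: f).
Proof.
have [_ _ IM] := ideal_gen_ideal rels; rewrite pres_scale.unlock; apply/pres_piP.
rewrite -scalerBr -mulr_algl.
by have := IM (k *: 1) _ 1 (repr_pres f); rewrite mulr1.
Qed.

Lemma pres_mulA : associative pres_mul.
Proof.
by move=> x y z; rewrite -[x]pres_reprK -[y]pres_reprK -[z]pres_reprK
  !pres_mulE mulrA.
Qed.

Lemma pres_mul1l : left_id pres_one pres_mul.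
Proof. by move=> x; rewrite -[x]pres_reprK pres_one.unlock pres_mulE mul1r. Qed.

Lemma pres_mul1r : right_id pres_one pres_mul.
Proof. by move=> x; rewrite -[x]pres_reprK pres_one.unlock pres_mulE mulr1. Qed.

Lemma pres_mulDl : left_distributive pres_mul +%R.
Proof.
by move=> x y z; rewrite -[x]pres_reprK -[y]pres_reprK -[z]pres_reprK
  -raddfD !pres_mulE -raddfD mulrDl.
Qed.

Lemma pres_mulDr : right_distributive pres_mul +%R.
Proof.
by move=> x y z; rewrite -[x]pres_reprK -[y]pres_reprK -[z]pres_reprK
  -raddfD !pres_mulE -raddfD mulrDr.
Qed.

HB.instance Definition _ := GRing.Zmodule_isPzRing.Build A
  pres_mulA pres_mul1l pres_mul1r pres_mulDl pres_mulDr.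

Lemma pres_scaleA k l (x : A) :
  pres_scale k (pres_scale l x) = pres_scale (k * l) x.
Proof. by rewrite -[x]pres_reprK !pres_scaleE scalerA. Qed.

Lemma pres_scale1 : left_id 1 pres_scale.
Proof. by move=> x; rewrite -[x]pres_reprK pres_scaleE scale1r. Qed.

Lemma pres_scaleDr : right_distributive pres_scale +%R.
Proof.
by move=> k x y; rewrite -[x]pres_reprK -[y]pres_reprK -raddfD !pres_scaleE
  -raddfD scalerDr.
Qed.

Lemma pres_scaleDl (x : A) : {morph pres_scale^~ x : k l / k + l}.
Proof.
by move=> k l; rewrite -[x]pres_reprK !pres_scaleE -raddfD scalerDl.
Qed.

HB.instance Definition _ := GRing.Zmodule_isLmodule.Build K A
  pres_scaleA pres_scale1 pres_scaleDr pres_scaleDl.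

Lemma pres_pi_is_monoid_morphism : monoid_morphism pres_pi.
Proof.
split=> [|f g]; last by rewrite -pres_mulE.
by rewrite -[RHS]/pres_one pres_one.unlock.
Qed.

HB.instance Definition _ :=
  GRing.isMonoidMorphism.Build F A pres_pi pres_pi_is_monoid_morphism.

Lemma pres_pi_is_scalable : scalable pres_pi.
Proof. by move=> k f; rewrite -pres_scaleE. Qed.

HB.instance Definition _ :=
  GRing.isScalable.Build K F A *:%R pres_pi pres_pi_is_scalable.

Lemma pres_scalerAl k (x y : A) : k *: (x * y) = (k *: x) * y.
Proof.
rewrite -[LHS]/(pres_scale k (pres_mul x y)) -[RHS]/(pres_mul (pres_scale k x) y).
by rewrite -[x]pres_reprK -[y]pres_reprK !(pres_mulE, pres_scaleE) scalerAl.
Qed.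

Lemma pres_scalerAr k (x y : A) : k *: (x * y) = x * (k *: y).
Proof.
rewrite -[LHS]/(pres_scale k (pres_mul x y)) -[RHS]/(pres_mul x (pres_scale k y)).
by rewrite -[x]pres_reprK -[y]pres_reprK !(pres_mulE, pres_scaleE) free_scalerAr.
Qed.

Definition pres_gen (i : 'I_n) : A := pres_pi (free_var K i).

Lemma pres_relP r : r \in rels -> pres_pi r = 0.
Proof.
by move=> rS; rewrite -(raddf0 pres_pi); apply/pres_piP; rewrite subr0 ideal_gen_mem.
Qed.

End PresAlg.

(* Every vector is a finite linear combination of the family b with uniquely
   determined (finitely supported) coefficients, i.e. V is the direct sum of
   the lines K b_i and all the b_i are nonzero. *)
Definition is_basis (K : fieldType) (V : lmodType K) (I : choiceType)
    (b : I -> V) : Prop :=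
  forall v : V, exists! c : {fsfun I -> K with 0},
    v = \sum_(i <- finsupp c) c i *: b i.

Section ThreeGenerators.

Definition i1 : 'I_3 := @Ordinal 3 0 isT.
Definition i2 : 'I_3 := @Ordinal 3 1 isT.
Definition i3 : 'I_3 := @Ordinal 3 2 isT.

Definition mon3 (A : pzRingType) (x : 'I_3 -> A) (e : {ffun 'I_3 -> nat}) : A :=
  x i1 ^+ e i1 * x i2 ^+ e i2 * x i3 ^+ e i3.

Variables (K : fieldType)
  (q1 q2 q3 a b c alpha beta gamma lambda mu nu b1 b2 b3 : K).

(* Each relation u = v is encoded by the element u - v of the free algebra. *)
Definition skew_rels : seq (free_alg K 3) :=
  let x1 := free_var K i1 in
  let x2 := free_var K i2 in
  let x3 := free_var K i3 in
  [:: (x2 * x1 - q1 *: (x1 * x2))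
        - (a *: x1 + b *: x2 + c *: x3 + b1 *: 1);
      (x3 * x1 - q2 *: (x1 * x3))
        - (alpha *: x1 + beta *: x2 + gamma *: x3 + b2 *: 1);
      (x3 * x2 - q3 *: (x2 * x3))
        - (lambda *: x1 + mu *: x2 + nu *: x3 + b3 *: 1)].

End ThreeGenerators.

(* Main.v *)
(* Everything is phrased with linear operators X1, X2, X3 on a K-module W that
   satisfy the three relations; write R for the defect of the third one.  When
   the first two hold, comparing the two reductions of X3 X2 X1 gives
     R X1 = (q1 q2 X1 + q1 gamma + b) R + (quadratic expression),
   where the coefficients of the ordered monomials in the quadratic expression
   are, up to signs and factors q_i, the defects of the ten conditions.
   - Taking for X_i left multiplication by x_i on A, so that R = 0, the linear
     independence of the ordered monomials forces the conditions.
   - Conversely the relations prescribe, by recursion on the degree, operators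
     X1, X2, X3 on the free module on N^3 which satisfy the first two relations
     by construction; under the conditions the quadratic expression vanishes,
     whence R = 0 by induction on the exponent of x1.  The module obtained in
     this way separates the ordered monomials.  That they span A needs no
     condition.
   - The conditions are invariant under the changes of parameters that
     exchange x1 with x2 and x2 with x3, and these generate S_3. *)

Require Import Defs.
From mathcomp Require Import all_boot all_algebra perm ring.
From mathcomp Require Import finmap.
From mathcomp.classical Require Import boolp.
From mathcomp.multinomials Require Import monalg.
From HB Require Import structures.

Set Implicit Arguments.
Unset Strict Implicit.
Unset Printing Implicit Defensive.

Import GRing.Theory.
Local Open Scope ring_scope.

(** * Linear extension and bases *)

Section LinearExtension.
Variables (K : fieldType) (I : choiceType) (W : lmodType K).
Implicit Types (f : I -> W) (g : {malg K[I]}).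

(** [{malg K[I]}] serves as the free module on I; this is its universal property. *)
Definition lext f g : W := \sum_(m <- msupp g) g@_m *: f m.

Lemma lextEw f g (d : {fset I}) : (msupp g `<=` d)%fset ->
  lext f g = \sum_(m <- d) g@_m *: f m.
Proof.
move=> le_d; rewrite /lext; apply: big_fset_incl => // m _ /mcoeff_outdom ->.
by rewrite scale0r.
Qed.

Lemma lext_is_linear f : linear (lext f).
Proof.
move=> k g h; pose d := (msupp g `|` msupp h)%fset.
have le_g : (msupp g `<=` d)%fset by apply: fsubsetUl.
have le_h : (msupp h `<=` d)%fset by apply: fsubsetUr.
have le_s : (msupp (k *: g + h) `<=` d)%fset.
  by apply: fsubset_trans (msuppD_le _ _) (fsetSU _ (msuppZ_le _ _)).
rewrite (lextEw f le_g) (lextEw f le_h) (lextEw f le_s).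
rewrite scaler_sumr -big_split; apply: eq_bigr => m _ /=.
by rewrite mcoeffD mcoeffZ scalerDl scalerA.
Qed.

HB.instance Definition _ f :=
  GRing.isLinear.Build K {malg K[I]} W *:%R (lext f) (lext_is_linear f).

Lemma lextU f m : lext f << m >> = f m.
Proof.
rewrite (lextEw f (d := [fset m]%fset)); last exact: msuppU_le.
by rewrite big_seq_fset1 mcoeffUU scale1r.
Qed.

Lemma malgUZ (c : K) (m : I) : << c *g m >> = c *: << m >> :> {malg K[I]}.
Proof. by apply/malgP => n; rewrite mcoeffZ !mcoeffU mulrnAr mulr1. Qed.

Lemma malg_sum_scale g : g = \sum_(m <- msupp g) g@_m *: << m >>.
Proof. by rewrite {1}[g]monalgE; apply: eq_bigr => m _; rewrite malgUZ. Qed.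

Lemma linear_malg_eq (h h' : {linear {malg K[I]} -> W}) :
  (forall m, h << m >> = h' << m >>) -> h =1 h'.
Proof.
move=> eq_h g; rewrite [g]malg_sum_scale !linear_sum.
by apply: eq_bigr => m _; rewrite !linearZ /= eq_h.
Qed.

Lemma eq_lext f f' : f =1 f' -> lext f =1 lext f'.
Proof. by move=> eq_f g; apply: eq_bigr => m _; rewrite eq_f. Qed.

(** An element of the free module is its finitely supported coefficient function, so existence and
    uniqueness of coordinates amount to surjectivity and trivial kernel of the linear map
    [lext f]. *)
Lemma is_basisP f : is_basis f <->
  (forall v, exists g, v = lext f g) /\ (forall g, lext f g = 0 -> g = 0).
Proof.
split=> [bas | [gen fr] v].
  split=> [v | g g0]; first by have [c [-> _]] := bas v; exists (Malg c).
  have [c [_ uniq_c]] := bas 0.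
  have /uniq_c c1 :
    0 = \sum_(i <- finsupp (malg_val g)) malg_val g i *: f i by [].
  have /uniq_c c2 : 0 = \sum_(i <- finsupp (malg_val (0 : {malg K[I]})))
     malg_val (0 : {malg K[I]}) i *: f i.
    by rewrite -[RHS]/(lext f 0) linear0.
  by apply/malgP => m; rewrite /mcoeff -c1 c2.
have [g ->] := gen v; exists (malg_val g); split=> // c eq_gc.
have : lext f (g - Malg c) = 0 by rewrite linearB /= eq_gc subrr.
by move/fr/eqP; rewrite subr_eq0 => /eqP ->.
Qed.

End LinearExtension.

Lemma lext_comp (K : fieldType) (I : choiceType) (U W : lmodType K)
    (h : {linear U -> W}) (f : I -> U) (g : {malg K[I]}) :
  h (lext f g) = lext (fun m => h (f m)) g.
Proof. by rewrite linear_sum; apply: eq_bigr => m _; rewrite linearZ. Qed.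

Lemma lext_id (K : fieldType) (I : choiceType) (g : {malg K[I]}) :
  lext (fun m => << m >>) g = g.
Proof. by rewrite [RHS]malg_sum_scale. Qed.

(** H and H' are mutually inverse maps between the free modules on J and I, and [lext (b \o h)] is
    [lext b] composed with H. *)
Lemma is_basis_reindex (K : fieldType) (V : lmodType K) (I J : choiceType)
    (h : J -> I) (h' : I -> J) (b : I -> V) :
  cancel h h' -> cancel h' h -> is_basis b -> is_basis (b \o h).
Proof.
move=> hK h'K /is_basisP[gen free]; apply/is_basisP.
pose H g : {malg K[I]} := lext (fun j => << h j >>) g.
pose H' g : {malg K[J]} := lext (fun i => << h' i >>) g.
have lextH g : lext b (H g) = lext (b \o h) g.
  by rewrite /H lext_comp; apply: eq_lext => j; exact: lextU.
have HK g : H' (H g) = g.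
  rewrite /H /H' lext_comp -[RHS](lext_id g); apply: eq_lext => j.
  by apply: etrans (lextU _ _) _; rewrite hK.
have H'K g : H (H' g) = g.
  rewrite /H /H' lext_comp -[RHS](lext_id g); apply: eq_lext => j.
  by apply: etrans (lextU _ _) _; rewrite h'K.
split=> [v | g]; first by have [g ->] := gen v; exists (H' g); rewrite -lextH H'K.
by rewrite -lextH => /free Hg0; rewrite -[g]HK Hg0 /H' linear0.
Qed.

(** * Deciding linear identities in a module *)

Section ModuleIdentities.
Variables (K : fieldType) (W : lmodType K).

(* Replacing the atoms of a linear identity in a module by powers of 'X turns
   it into an identity of polynomials, which [ring] can decide. *)
Definition pcomb (u : seq W) (p : {poly K}) : W :=
  \sum_(i < size u) p`_i *: u`_i.

Lemma pcombD u p q : pcomb u p + pcomb u q = pcomb u (p + q).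
Proof.
by rewrite -big_split; apply: eq_bigr => i _; rewrite coefD scalerDl.
Qed.

Lemma pcombZ u k p : k *: pcomb u p = pcomb u (k%:P * p).
Proof.
by rewrite scaler_sumr; apply: eq_bigr => i _; rewrite coefCM scalerA.
Qed.

Lemma pcombN u p : - pcomb u p = pcomb u (- p).
Proof. by rewrite -scaleN1r pcombZ rmorphN mulN1r. Qed.

Lemma pcombX u i : (i < size u)%N -> u`_i = pcomb u 'X^i.
Proof.
move=> lt_i; rewrite /pcomb (bigD1 (Ordinal lt_i)) //= coefXn eqxx scale1r.
rewrite big1 ?addr0 // => j ne_j; rewrite coefXn.
by rewrite (negbTE (_ : (j : nat) != i)) ?scale0r //; apply: contra ne_j.
Qed.

Definition pcombE := (pcombZ, pcombN, pcombD).

End ModuleIdentities.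

(** The atom of index i stands for ['X^i]. The list s loses its body before the rewriting starts, so
    [pcomb s] is from then on an opaque function of the polynomial. *)
Ltac reify_atoms s l i :=
  lazymatch l with
  | ?u :: ?l' =>
      let H := fresh "H" in
      pose proof (@pcombX _ _ s i isT : u = pcomb s 'X^i) as H;
      reify_atoms s l' (S i); rewrite ?H; clear H
  | _ => clearbody s
  end.

Ltac module_ring l :=
  let s := fresh "s" in
  pose s := l; reify_atoms s l 0%N; rewrite ?pcombE;
  congr (pcomb s _); ring.

(** * The overlap of the three relations *)

Section Defect.
Variables (K : fieldType) (W : lmodType K).

(** The pair X, Y is kept apart from Z1, Z2, Z3 so that all three relations, and their forms after
    exchanging generators, are instances. *)
Definition defect (q a b c d : K) (X Y Z1 Z2 Z3 : {linear W -> W}) (v : W) : W :=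
  X (Y v) - q *: Y (X v) - (a *: Z1 v + b *: Z2 v + c *: Z3 v + d *: v).

Lemma defect_is_linear q a b c d X Y Z1 Z2 Z3 :
  linear (defect q a b c d X Y Z1 Z2 Z3).
Proof.
move=> k u v; rewrite /defect !linearP /=.
move: (X (Y u)) (X (Y v)) (Y (X u)) (Y (X v)) => u1 v1 u2 v2.
move: (Z1 u) (Z1 v) (Z2 u) (Z2 v) (Z3 u) (Z3 v) => u3 v3 u4 v4 u5 v5.
module_ring [:: u; v; u1; v1; u2; v2; u3; v3; u4; v4; u5; v5].
Qed.

HB.instance Definition _ q a b c d X Y Z1 Z2 Z3 :=
  GRing.isLinear.Build K W W *:%R (defect q a b c d X Y Z1 Z2 Z3)
    (defect_is_linear q a b c d X Y Z1 Z2 Z3).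

Lemma defect_eq0 q a b c d X Y Z1 Z2 Z3 v :
  defect q a b c d X Y Z1 Z2 Z3 v = 0 <->
  X (Y v) = q *: Y (X v) + (a *: Z1 v + b *: Z2 v + c *: Z3 v + d *: v).
Proof.
rewrite /defect -addrA -opprD.
by split=> [/eqP | ->]; rewrite ?subrr // subr_eq0 => /eqP.
Qed.

End Defect.

(** Bundled so that exchanging two generators becomes a map on parameters. *)
Record params (K : Type) := Params {
  pq1 : K; pq2 : K; pq3 : K; pa : K; pb : K; pc : K;
  palpha : K; pbeta : K; pgamma : K; plambda : K; pmu : K; pnu : K;
  pb1 : K; pb2 : K; pb3 : K }.

Section Overlap.
Variables (K : fieldType) (p : params K).

Definition admissible : bool := [&& pq1 p != 0, pq2 p != 0 & pq3 p != 0].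

Definition consistent : Prop := let:
  Params q1 q2 q3 a b c alpha beta gamma lambda mu nu b1 b2 b3 := p in
  [/\ [/\ (1 - q3) * alpha = (1 - q2) * mu,
          (1 - q3) * a = (1 - q1) * nu,
          (1 - q2) * b = (1 - q1) * gamma,
          (1 - q1 * q2) * lambda = 0 &
          (q1 - q3) * beta = 0],
      (1 - q2 * q3) * c = 0,
      ((1 - q3) * alpha - mu) * a + (b + q1 * gamma) * lambda - nu * alpha
        + (q1 * q2 - 1) * b3 = 0,
      (a - nu) * beta + q1 * gamma * mu - q3 * alpha * b + (q1 - q3) * b2 = 0 &
      (a + (q1 - 1) * nu) * gamma + b * nu - (mu + q3 * alpha) * c
        + (1 - q2 * q3) * b1 = 0
   /\ - (mu + q3 * alpha) * b1 + (a - nu) * b2 + (b + q1 * gamma) * b3 = 0].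

Section Operators.
Variables (W : lmodType K) (X1 X2 X3 : {linear W -> W}).

Definition defect21 :=
  defect (pq1 p) (pa p) (pb p) (pc p) (pb1 p) X2 X1 X1 X2 X3.
Definition defect31 :=
  defect (pq2 p) (palpha p) (pbeta p) (pgamma p) (pb2 p) X3 X1 X1 X2 X3.
Definition defect32 :=
  defect (pq3 p) (plambda p) (pmu p) (pnu p) (pb3 p) X3 X2 X1 X2 X3.

Definition skew_rep :=
  [/\ forall v, defect21 v = 0, forall v, defect31 v = 0
    & forall v, defect32 v = 0].

Lemma overlap v : (forall w, defect21 w = 0) -> (forall w, defect31 w = 0) ->
  let: Params q1 q2 q3 a b c alpha beta gamma lambda mu nu b1 b2 b3 := p in
  defect32 (X1 v) =
    (q1 * q2) *: X1 (defect32 v) + (q1 * gamma + b) *: defect32 v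
    - ((1 - q1 * q2) * lambda) *: X1 (X1 v)
    + (q1 * ((1 - q3) * alpha - (1 - q2) * mu)) *: X1 (X2 v)
    + (q2 * ((1 - q3) * a - (1 - q1) * nu)) *: X1 (X3 v)
    + ((q1 - q3) * beta) *: X2 (X2 v)
    + (q3 * ((1 - q2) * b - (1 - q1) * gamma)) *: X2 (X3 v)
    + ((1 - q2 * q3) * c) *: X3 (X3 v)
    + (((1 - q3) * alpha - mu) * a + (b + q1 * gamma) * lambda - nu * alpha
        + (q1 * q2 - 1) * b3) *: X1 v
    + ((a - nu) * beta + q1 * gamma * mu - q3 * alpha * b + (q1 - q3) * b2) *: X2 v
    + ((a + (q1 - 1) * nu) * gamma + b * nu - (mu + q3 * alpha) * c
        + (1 - q2 * q3) * b1) *: X3 v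
    + (- (mu + q3 * alpha) * b1 + (a - nu) * b2 + (b + q1 * gamma) * b3) *: v.
Proof.
rewrite /defect32 /defect21 /defect31.
case: p => q1 q2 q3 a b c alpha beta gamma lambda mu nu b1 b2 b3 /= r21 r31.
have {r21}e21 w := (defect_eq0 _ _ _ _ _ _ _ _ _ _ _).1 (r21 w).
have {r31}e31 w := (defect_eq0 _ _ _ _ _ _ _ _ _ _ _).1 (r31 w).
have eD (X : {linear W -> W}) u w : X (u + w) = X u + X w := linearD X u w.
have eN (X : {linear W -> W}) u : X (- u) = - X u := linearN X u.
have eZ (X : {linear W -> W}) k u : X (k *: u) = k *: X u := linearZ_LR X k u.
rewrite /defect.
(* Rewriting with [e21] and [e31] moves X1 to the front. X3 X2 is never reordered, so [X3 (X2 v)]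
   and [X1 (X3 (X2 v))] stay as atoms, which the two [defect32] terms on the right absorb. *)
pose E := (e21, e31, (eD X1, eD X2, eD X3), (eN X1, eN X2, eN X3),
  (eZ X1, eZ X2, eZ X3)).
rewrite !E {E}.
move: (X1 (X2 (X3 v))) (X1 (X3 (X2 v))) => u1 u2.
move: (X1 (X1 v)) (X1 (X2 v)) (X1 (X3 v)) (X2 (X2 v)) => u3 u4 u5 u6.
move: (X2 (X3 v)) (X3 (X2 v)) (X3 (X3 v)) => u7 u8 u9.
move: (X1 v) (X2 v) (X3 v) => u10 u11 u12.
module_ring [:: v; u1; u2; u3; u4; u5; u6; u7; u8; u9; u10; u11; u12].
Qed.

End Operators.
End Overlap.

(** * Permuting the generators *)

Section Permutation.
Variable K : fieldType.
Implicit Types p : params K.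

Lemma defect_inv (W : lmodType K) (q a b c d : K)
    (X Y Z1 Z2 Z3 : {linear W -> W}) v :
  q != 0 ->
  defect q^-1 (- (q^-1 * a)) (- (q^-1 * b)) (- (q^-1 * c)) (- (q^-1 * d))
    Y X Z1 Z2 Z3 v = - q^-1 *: defect q a b c d X Y Z1 Z2 Z3 v.
Proof.
move=> q_neq0; rewrite /defect.
move: (X (Y v)) (Y (X v)) (Z1 v) (Z2 v) (Z3 v) => u w z1 z2 z3.
(* With [q *: w] as the new atom no product of q and its inverse is left to cancel, and [ring]
   suffices. *)
rewrite -{1}[w](scalerK q_neq0).
move: (q *: w) => {}w.
module_ring [:: u; w; z1; z2; z3; v].
Qed.

Lemma defect_swap12 (W : lmodType K) (q a b c d : K)
    (X Y Z1 Z2 Z3 : {linear W -> W}) v :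
  defect q b a c d X Y Z2 Z1 Z3 v = defect q a b c d X Y Z1 Z2 Z3 v.
Proof. by rewrite /defect [b *: _ + _]addrC. Qed.

Lemma defect_swap23 (W : lmodType K) (q a b c d : K)
    (X Y Z1 Z2 Z3 : {linear W -> W}) v :
  defect q a c b d X Y Z1 Z3 Z2 v = defect q a b c d X Y Z1 Z2 Z3 v.
Proof. by rewrite /defect [a *: _ + _ + _]addrAC. Qed.

(* Parameters of the presentation on the generators x2, x1, x3. *)
Definition swap12 p : params K := let:
  Params q1 q2 q3 a b c alpha beta gamma lambda mu nu b1 b2 b3 := p in
  Params q1^-1 q3 q2 (- (q1^-1 * b)) (- (q1^-1 * a)) (- (q1^-1 * c))
    mu lambda nu beta alpha gamma (- (q1^-1 * b1)) b3 b2.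

(* Parameters of the presentation on the generators x1, x3, x2. *)
Definition swap23 p : params K := let:
  Params q1 q2 q3 a b c alpha beta gamma lambda mu nu b1 b2 b3 := p in
  Params q2 q1 q3^-1 alpha gamma beta a c b
    (- (q3^-1 * lambda)) (- (q3^-1 * nu)) (- (q3^-1 * mu)) b2 b1 (- (q3^-1 * b3)).

Lemma swap12K p : admissible p -> swap12 (swap12 p) = p.
Proof.
case: p => q1 q2 q3 a b c alpha beta gamma lambda mu nu b1 b2 b3.
case/and3P=> /= q1_neq0 _ _.
by rewrite invrK !mulrN !opprK !mulVKf.
Qed.

Lemma swap23K p : admissible p -> swap23 (swap23 p) = p.
Proof.
case: p => q1 q2 q3 a b c alpha beta gamma lambda mu nu b1 b2 b3.
case/and3P=> /= _ _ q3_neq0.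
by rewrite invrK !mulrN !opprK !mulVKf.
Qed.

Lemma swap12_admissible p : admissible p -> admissible (swap12 p).
Proof. by case: p => *; rewrite /admissible /= invr_eq0 [X in _ && X]andbC. Qed.

Lemma swap23_admissible p : admissible p -> admissible (swap23 p).
Proof. by case: p => *; rewrite /admissible /= invr_eq0 andbCA. Qed.

(** Each new condition is k times an old one, the last four corrected by e times D, the difference
    of the two sides of the first condition. There e is b, a, c or b1 divided by q1. *)
Lemma swap12_consistent p : admissible p -> consistent p -> consistent (swap12 p).
Proof.
case: p => q1 q2 q3 a b c alpha beta gamma lambda mu nu b1 b2 b3.
move=> /and3P[/= q1_neq0 q2_neq0 q3_neq0] [[h1 h2 h3 h4 h5] h6 h7 h8 [h9 h10]].
pose D := (1 - q3) * alpha - (1 - q2) * mu.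
have derive k e x y x' y' : x' = y' -> x - y = k * (x' - y') + e * D -> x = y.
  move=> -> eq_xy; apply: subr0_eq.
  by rewrite eq_xy /D h1 !subrr !mulr0 addr0.
split; first split.
- by apply: (derive (-1) 0) h1 _; ring.
- by apply: (derive (- q1^-1) 0) h3 _; field.
- by apply: (derive (- q1^-1) 0) h2 _; field.
- by apply: (derive q1^-1 0) h5 _; field.
- by apply: (derive q1^-1 0) h4 _; field.
- by apply: (derive (- q1^-1) 0) h6 _; field.
- by apply: (derive (- q1^-1) (q1^-1 * b)) h8 _; rewrite /D; field.
- by apply: (derive (- q1^-1) (q1^-1 * a)) h7 _; rewrite /D; field.
split.
- by apply: (derive (- q1^-1) (q1^-1 * c)) h9 _; rewrite /D; field.
- by apply: (derive (- q1^-1) (q1^-1 * b1)) h10 _; rewrite /D; field.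
Qed.

(** Same scheme as for [swap12]; the correction term E now comes from the third condition, and its
    factors are the coefficients of the third relation divided by q3. *)
Lemma swap23_consistent p : admissible p -> consistent p -> consistent (swap23 p).
Proof.
case: p => q1 q2 q3 a b c alpha beta gamma lambda mu nu b1 b2 b3.
move=> /and3P[/= q1_neq0 q2_neq0 q3_neq0] [[h1 h2 h3 h4 h5] h6 h7 h8 [h9 h10]].
pose E := (1 - q2) * b - (1 - q1) * gamma.
have derive k e x y x' y' : x' = y' -> x - y = k * (x' - y') + e * E -> x = y.
  move=> -> eq_xy; apply: subr0_eq.
  by rewrite eq_xy /E h3 !subrr !mulr0 addr0.
split; first split.
- by apply: (derive (- q3^-1) 0) h2 _; field.
- by apply: (derive (- q3^-1) 0) h1 _; field.
- by apply: (derive (-1) 0) h3 _; ring.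
- by apply: (derive (- q3^-1) 0) h4 _; field.
- by apply: (derive (- q3^-1) 0) h6 _; field.
- by apply: (derive (- q3^-1) 0) h5 _; field.
- by apply: (derive (- q3^-1) (q3^-1 * lambda)) h7 _; rewrite /E; field.
- by apply: (derive (- q3^-1) (q3^-1 * nu)) h9 _; rewrite /E; field.
split.
- by apply: (derive (- q3^-1) (q3^-1 * mu)) h8 _; rewrite /E; field.
- by apply: (derive (- q3^-1) (q3^-1 * b3)) h10 _; rewrite /E; field.
Qed.

Lemma swap12_rep p (W : lmodType K) (X1 X2 X3 : {linear W -> W}) :
  admissible p -> skew_rep p X1 X2 X3 -> skew_rep (swap12 p) X2 X1 X3.
Proof.
case: p => q1 q2 q3 a b c alpha beta gamma lambda mu nu b1 b2 b3.
case/and3P=> /= q1_neq0 _ _; rewrite /skew_rep /defect21 /defect31 /defect32 /=.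
case=> r21 r31 r32; split=> v.
- by rewrite defect_swap12 defect_inv // r21 scaler0.
- by rewrite defect_swap12.
- by rewrite defect_swap12.
Qed.

Lemma swap23_rep p (W : lmodType K) (X1 X2 X3 : {linear W -> W}) :
  admissible p -> skew_rep p X1 X2 X3 -> skew_rep (swap23 p) X1 X3 X2.
Proof.
case: p => q1 q2 q3 a b c alpha beta gamma lambda mu nu b1 b2 b3.
case/and3P=> /= _ _ q3_neq0; rewrite /skew_rep /defect21 /defect31 /defect32 /=.
case=> r21 r31 r32; split=> v.
- by rewrite defect_swap23.
- by rewrite defect_swap23.
- by rewrite defect_swap23 defect_inv // r32 scaler0.
Qed.

Lemma swap12_repE p (W : lmodType K) (X1 X2 X3 : {linear W -> W}) :
  admissible p -> skew_rep p X1 X2 X3 <-> skew_rep (swap12 p) X2 X1 X3.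
Proof.
move=> adm_p; split; first exact: swap12_rep.
by move/swap12_rep; rewrite swap12K //; apply; apply: swap12_admissible.
Qed.

Lemma swap23_repE p (W : lmodType K) (X1 X2 X3 : {linear W -> W}) :
  admissible p -> skew_rep p X1 X2 X3 <-> skew_rep (swap23 p) X1 X3 X2.
Proof.
move=> adm_p; split; first exact: swap23_rep.
by move/swap23_rep; rewrite swap23K //; apply; apply: swap23_admissible.
Qed.

(** Reduces an arbitrary order of the generators to the standard one. Both directions of the
    equivalence serve: one sends left multiplications on the algebra to p', the other brings a
    module built for p' back to p. *)
Lemma permuted_params p (s : 'S_3) : admissible p -> consistent p ->
  exists2 p', consistent p' &
    forall (W : lmodType K) (X : 'I_3 -> {linear W -> W}),
    skew_rep p (X i1) (X i2) (X i3) <->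
    skew_rep p' (X (s i1)) (X (s i2)) (X (s i3)).
Proof.
have ord3 (i : 'I_3) : [\/ i = i1, i = i2 | i = i3].
  case: i => [[|[|[|//]]] lt_i]; [apply: Or31 | apply: Or32 | apply: Or33];
  exact/val_inj.
have neq12 : s i1 <> s i2 by move/perm_inj.
have neq13 : s i1 <> s i3 by move/perm_inj.
have neq23 : s i2 <> s i3 by move/perm_inj.
move=> adm_p con_p.
have [adm12 adm23] := (swap12_admissible adm_p, swap23_admissible adm_p).
have con12 := swap12_consistent adm_p con_p.
have con23 := swap23_consistent adm_p con_p.
have [adm1223 adm2312] := (swap23_admissible adm12, swap12_admissible adm23).
(* Injectivity leaves six triples. The swaps act on positions, and the innermost is performed
   first. *)
case: (ord3 (s i1)) (ord3 (s i2)) (ord3 (s i3)) neq12 neq13 neq23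
  => -> [] -> [] -> // _ _ _.
- by exists p.
- by exists (swap23 p) => // W X; exact: swap23_repE.
- by exists (swap12 p) => // W X; exact: swap12_repE.
- exists (swap23 (swap12 p)) => [|W X]; first exact: swap23_consistent.
  by rewrite swap12_repE // swap23_repE.
- exists (swap12 (swap23 p)) => [|W X]; first exact: swap12_consistent.
  by rewrite swap23_repE // swap12_repE.
exists (swap12 (swap23 (swap12 p))) => [|W X].
  by apply: swap12_consistent => //; apply: swap23_consistent.
by rewrite swap12_repE // swap23_repE // swap12_repE.
Qed.

End Permutation.

(** * Ordered monomials span *)

Section Span.
Variables (K : fieldType) (I : Type) (W : lmodType K).
Implicit Types (P : pred I) (e : I -> W).

(** An inductive linear span: closure under linear maps follows by induction, without handling
    coefficient families. *)
Inductive spanned P e : W -> Prop :=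
| spanned0 : spanned P e 0
| spanned_cons k m w : P m -> spanned P e w -> spanned P e (k *: e m + w).

Lemma spannedD P e u w : spanned P e u -> spanned P e w -> spanned P e (u + w).
Proof.
elim=> [|k m v Pm _ IHv] span_w; first by rewrite add0r.
by rewrite -addrA; apply: spanned_cons Pm (IHv span_w).
Qed.

Lemma spannedZ P e k w : spanned P e w -> spanned P e (k *: w).
Proof.
elim=> [|l m v Pm _ IHv]; first by rewrite scaler0; apply: spanned0.
by rewrite scalerDr scalerA; apply: spanned_cons.
Qed.

Lemma spannedU P e m : P m -> spanned P e (e m).
Proof.
move=> Pm; rewrite -[e m]scale1r -[_ *: _]addr0.
exact: spanned_cons (spanned0 _ _).
Qed.

Lemma eq_spanned P e (U : lmodType K) (h h' : {linear W -> U}) w :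
  (forall m, P m -> h (e m) = h' (e m)) -> spanned P e w -> h w = h' w.
Proof.
move=> eq_h; elim=> [|k m v Pm _ IHv]; first by rewrite !linear0.
by rewrite !linearP /= IHv eq_h.
Qed.

End Span.

Lemma spanned_map (K : fieldType) (I J : Type) (U W : lmodType K) (P : pred I)
    (Q : pred J) (e : I -> U) (f : J -> W) (h : {linear U -> W}) w :
  (forall m, P m -> spanned Q f (h (e m))) -> spanned P e w -> spanned Q f (h w).
Proof.
move=> Qf; elim=> [|k m v Pm _ IHv]; first by rewrite linear0; apply: spanned0.
by rewrite linearP /=; apply: spannedD => //; apply/spannedZ/Qf.
Qed.

Lemma sub_spanned (K : fieldType) (I : Type) (W : lmodType K) (P Q : pred I)
    (e : I -> W) w :
  subpred P Q -> spanned P e w -> spanned Q e w.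
Proof.
move=> PQ; elim=> [|k m v /PQ Qm _ IHv]; [exact: spanned0 | exact: spanned_cons].
Qed.

(** * Recursion on the degree *)

Notation mon := (nat * nat * nat)%type.

Definition deg (m : mon) : nat := (m.1.1 + m.1.2 + m.2)%N.

(* [step2] and [step3] express X2 e_m and X3 e_m through the values Y2 and Y3
   of X2 and X3 on basis vectors of lower degree, where e_m is the ordered
   monomial of exponent m; T stands for X2, up to the degree of m. *)
Section Steps.
Variables (K : fieldType) (W : lmodType K) (p : params K) (e : mon -> W).
Variable X1 : {linear W -> W}.
Hypothesis X1e : forall i j k, X1 (e (i, j, k)) = e (i.+1, j, k).
Implicit Types (Y : mon -> W) (T : {linear W -> W}).

Definition step2 Y2 Y3 (m : mon) : W :=
  match m with
  | (S i, j, k) =>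
      pq1 p *: X1 (Y2 (i, j, k)) +
      (pa p *: e (i.+1, j, k) + pb p *: Y2 (i, j, k) + pc p *: Y3 (i, j, k)
        + pb1 p *: e (i, j, k))
  | (O, j, k) => e (0%N, j.+1, k)
  end.

Definition step3 T Y2 Y3 (m : mon) : W :=
  match m with
  | (S i, j, k) =>
      pq2 p *: X1 (Y3 (i, j, k)) +
      (palpha p *: e (i.+1, j, k) + pbeta p *: Y2 (i, j, k)
        + pgamma p *: Y3 (i, j, k) + pb2 p *: e (i, j, k))
  | (O, S j, k) =>
      pq3 p *: T (Y3 (0%N, j, k)) +
      (plambda p *: e (1%N, j, k) + pmu p *: e (0%N, j.+1, k)
        + pnu p *: Y3 (0%N, j, k) + pb3 p *: e (0%N, j, k))
  | (O, O, k) => e (0%N, 0%N, k.+1)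
  end.

Definition filt n := spanned (fun m => deg m <= n)%N e.

(** In degrees below n, Y raises the degree by at most one. This is what makes the recursion well
    founded. *)
Definition bounded n Y := forall m : mon, (deg m < n)%N -> filt (deg m).+1 (Y m).

Lemma filtW n n' w : (n <= n')%N -> filt n w -> filt n' w.
Proof. by move=> le_n; apply: sub_spanned => m /leq_trans; apply. Qed.

Lemma filtU m n : (deg m <= n)%N -> filt n (e m).
Proof. by move=> le_m; apply: spannedU. Qed.

Lemma filt_X1 n w : filt n w -> filt n.+1 (X1 w).
Proof.
apply: spanned_map => -[[i j] k] le_n; rewrite X1e; apply: filtU.
by move: le_n; rewrite /deg /= !addSn.
Qed.

Lemma filt_affine n k a b c d u w1 w2 w3 w4 :
  filt n u -> filt n w1 -> filt n w2 -> filt n w3 -> filt n w4 ->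
  filt n (k *: u + (a *: w1 + b *: w2 + c *: w3 + d *: w4)).
Proof. by move=> *; do ![apply: spannedD | apply: spannedZ]. Qed.

Lemma step2_bounded n Y2 Y3 : bounded n Y2 -> bounded n Y3 ->
  bounded n.+1 (step2 Y2 Y3).
Proof.
move=> bY2 bY3 [[[|i] j] k] /= lt_m; first by apply: filtU; rewrite /deg /= addnS.
have lt_m' : (deg (i, j, k) < n)%N by move: lt_m; rewrite /deg /= !addSn ltnS.
have -> : deg (i.+1, j, k) = (deg (i, j, k)).+1 by rewrite /deg /= !addSn.
apply: filt_affine; first exact/filt_X1/bY2.
- by apply: filtU; rewrite /deg /= !addSn.
- exact/(filtW (leqnSn _))/bY2.
- exact/(filtW (leqnSn _))/bY3.
by apply: filtU; rewrite ltnW.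
Qed.

(** The delicate clause applies T to [Y3 (0, j, k)]. This vector has degree at most that of (0, j+1,
    k), so T must be controlled one degree further than Y2 and Y3. *)
Lemma step3_bounded n T Y2 Y3 : bounded n Y2 -> bounded n Y3 ->
  bounded n.+1 (T \o e) -> bounded n.+1 (step3 T Y2 Y3).
Proof.
move=> bY2 bY3 bT [[[|i] j] k] lt_m.
  case: j lt_m => [|j] lt_m; first exact: filtU.
  have lt_m' : (deg (0, j, k) < n)%N by move: lt_m; rewrite /deg /= !addSn ltnS.
  have -> : deg (0, j.+1, k)%N = (deg (0, j, k)%N).+1 by rewrite /deg /= !addSn.
  apply: filt_affine.
  - apply: spanned_map (bY3 _ lt_m') => m le_m.
    by apply: (@filtW (deg m).+1) => //; apply: bT; rewrite ltnS (leq_trans le_m).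
  - by apply: filtU; rewrite /deg /= !add0n !addSn.
  - by apply: filtU; rewrite /deg /= !add0n !addSn.
  - exact/(filtW (leqnSn _))/bY3.
  by apply: filtU; rewrite ltnW.
have lt_m' : (deg (i, j, k) < n)%N by move: lt_m; rewrite /deg /= !addSn ltnS.
have -> : deg (i.+1, j, k) = (deg (i, j, k)).+1 by rewrite /deg /= !addSn.
apply: filt_affine; first exact/filt_X1/bY3.
- by apply: filtU; rewrite /deg /= !addSn.
- exact/(filtW (leqnSn _))/bY2.
- exact/(filtW (leqnSn _))/bY3.
by apply: filtU; rewrite ltnW.
Qed.

Definition agree n Y Y' := forall m : mon, (deg m < n)%N -> Y m = Y' m.

Lemma step2_agree n Y2 Y3 Y2' Y3' : agree n Y2 Y2' -> agree n Y3 Y3' ->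
  agree n.+1 (step2 Y2 Y3) (step2 Y2' Y3').
Proof.
move=> a2 a3 [[[|i] j] k] //; rewrite /deg /= !addSn ltnS => lt_m.
by rewrite a2 // a3.
Qed.

Lemma step3_agree n T T' Y2 Y3 Y2' Y3' : bounded n Y3 ->
  agree n Y2 Y2' -> agree n Y3 Y3' -> agree n.+1 (T \o e) (T' \o e) ->
  agree n.+1 (step3 T Y2 Y3) (step3 T' Y2' Y3').
Proof.
move=> bY3 a2 a3 aT [[[|i] j] k]; last first.
  by rewrite /deg /= !addSn ltnS => lt_m; rewrite a2 // a3.
case: j => [|j] // lt_m.
have lt_m' : (deg (0, j, k) < n)%N by move: lt_m; rewrite /deg /= !addSn ltnS.
rewrite /= -a3 //; congr (_ *: _ + _); apply: eq_spanned (bY3 _ lt_m') => m le_m.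
by apply: aT; rewrite ltnS (leq_trans le_m).
Qed.

End Steps.

(** * Ordered monomials in an arbitrary representation *)

Section Spanning.
Variables (K : fieldType) (W : lmodType K) (p : params K).
Variables (X1 X2 X3 : {linear W -> W}) (w0 : W).

Definition ordered_monomial (m : mon) : W :=
  let: (i, j, k) := m in iter i X1 (iter j X2 (iter k X3 w0)).

Local Notation e := ordered_monomial.

(** Each clause is one of the relations applied to the monomial with its first letter removed, or
    holds by definition. *)
Lemma ordered_monomial_step : skew_rep p X1 X2 X3 ->
  (forall m, X2 (e m) = step2 p e X1 (X2 \o e) (X3 \o e) m) /\
  (forall m, X3 (e m) = step3 p e X1 X2 (X2 \o e) (X3 \o e) m).
Proof.
case=> r21 r31 r32; split=> [[[[|i] j] k]|[[[|i] [|j]] k]] //=.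
- by have /defect_eq0 -> := r21 (iter i X1 (iter j X2 (iter k X3 w0))).
- by have /defect_eq0 -> := r32 (iter j X2 (iter k X3 w0)).
- by have /defect_eq0 -> := r31 (iter i X1 (iter k X3 w0)).
by have /defect_eq0 -> := r31 (iter i X1 (X2 (iter j X2 (iter k X3 w0)))).
Qed.

(** At each degree X2 is treated before X3, because [step3] uses X2 up to the current degree. *)
Lemma ordered_monomial_bounded n : skew_rep p X1 X2 X3 ->
  bounded e n (X2 \o e) /\ bounded e n (X3 \o e).
Proof.
move=> rep; have [e2 e3] := ordered_monomial_step rep.
have X1e i j k : X1 (e (i, j, k)) = e (i.+1, j, k) by [].
elim: n => [|n [IH2 IH3]]; first by split.
have b2 : bounded e n.+1 (X2 \o e).
  by move=> m lt_m; rewrite /= e2; apply: (step2_bounded p X1e IH2 IH3).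
by split=> // m lt_m; rewrite /= e3; apply: (step3_bounded p X1e IH2 IH3 b2).
Qed.

Lemma ordered_monomial_stable w : skew_rep p X1 X2 X3 -> spanned predT e w ->
  [/\ spanned predT e (X1 w), spanned predT e (X2 w) & spanned predT e (X3 w)].
Proof.
move=> rep span_w; split; apply: spanned_map span_w => m _.
- by case: m => [[i j] k]; apply: (@spannedU _ _ _ predT e (i.+1, j, k)).
- have [b _] := ordered_monomial_bounded (deg m).+1 rep.
  exact: sub_spanned (b m (leqnn _)).
have [_ b] := ordered_monomial_bounded (deg m).+1 rep.
exact: sub_spanned (b m (leqnn _)).
Qed.

End Spanning.

(** * The universal module *)

Section Construction.
Variables (K : fieldType) (p : params K).

Local Notation V := {malg K[mon]}.

Definition basis_vec (m : mon) : V := << m >>.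
Local Notation e := basis_vec.

Lemma lext_basis (U : lmodType K) (f : mon -> U) m : lext f (e m) = f m.
Proof. exact: lextU. Qed.

Lemma eq0_on_basis (U : lmodType K) (h : {linear V -> U}) :
  (forall m, h (e m) = 0) -> forall v, h v = 0.
Proof. by move=> h0 v; rewrite (@linear_malg_eq _ _ _ h \0). Qed.

Definition shift1 (m : mon) : V := let: (i, j, k) := m in e (i.+1, j, k).
Definition op1 : {linear V -> V} := lext shift1.

Lemma op1E i j k : op1 (e (i, j, k)) = e (i.+1, j, k).
Proof. exact: lext_basis. Qed.

(** The stages of the recursion for X2 and X3, started from the dummy value 0. Stage n is meaningful
    in degrees below n only. The second component uses the first one of the same stage, since
    [step3] needs X2 up to the degree of m. *)
Fixpoint approx n : (mon -> V) * (mon -> V) :=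
  if n is n'.+1 then
    let Y2 := step2 p e op1 (approx n').1 (approx n').2 in
    (Y2, step3 p e op1 (lext Y2) (approx n').1 (approx n').2)
  else (fun=> 0, fun=> 0).

Lemma approxS2 n :
  (approx n.+1).1 = step2 p e op1 (approx n).1 (approx n).2.
Proof. exact: erefl. Qed.

Lemma approxS3 n :
  (approx n.+1).2 = step3 p e op1 (lext (approx n.+1).1) (approx n).1 (approx n).2.
Proof. exact: erefl. Qed.

Lemma bounded_lext n (Y : mon -> V) : bounded e n Y -> bounded e n (lext Y \o e).
Proof. by move=> bY m lt_m; rewrite /= lext_basis; apply: bY. Qed.

Lemma approx_bounded n : bounded e n (approx n).1 /\ bounded e n (approx n).2.
Proof.
elim: n => [|n [IH2 IH3]]; first by split.
have b2 := step2_bounded p op1E IH2 IH3.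
split; first exact: b2.
exact: (step3_bounded p op1E IH2 IH3 (bounded_lext b2)).
Qed.

Lemma agree_lext n (Y Y' : mon -> V) :
  agree n Y Y' -> agree n (lext Y \o e) (lext Y' \o e).
Proof. by move=> aY m lt_m; rewrite /= !lext_basis aY. Qed.

Lemma approx_agree n :
  agree n (approx n).1 (approx n.+1).1 /\ agree n (approx n).2 (approx n.+1).2.
Proof.
elim: n => [|n [IH2 IH3]]; first by split.
have a2 := step2_agree p e op1 IH2 IH3.
have [_ b3] := approx_bounded n.
split; first exact: a2.
exact: (step3_agree p op1 b3 IH2 IH3 (agree_lext a2)).
Qed.

(** Stage deg m + 1 is the first at which the value at m is final. *)
Definition shift2 m : V := (approx (deg m).+1).1 m.
Definition shift3 m : V := (approx (deg m).+1).2 m.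
Definition op2 : {linear V -> V} := lext shift2.
Definition op3 : {linear V -> V} := lext shift3.

Lemma approx_shift n : agree n (approx n).1 shift2 /\ agree n (approx n).2 shift3.
Proof.
(* Every stage beyond deg m is written as d + (deg m + 1), for an induction on d. *)
suff approxD d m : (approx (d + (deg m).+1)).1 m = shift2 m /\
                   (approx (d + (deg m).+1)).2 m = shift3 m.
  have eq_approx m : (deg m < n)%N ->
      (approx n).1 m = shift2 m /\ (approx n).2 m = shift3 m.
    by move=> lt_m; have := approxD (n - (deg m).+1)%N m; rewrite subnK.
  by split=> m lt_m; have [e2 e3] := eq_approx m lt_m; [exact: e2 | exact: e3].
elim: d => [|d [<- <-]]; first by split; exact: erefl.
have [a2 a3] := approx_agree (d + (deg m).+1).
have lt_m : (deg m < d + (deg m).+1)%N by rewrite addnS ltnS leq_addl.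
by split; symmetry; [apply: a2 | apply: a3].
Qed.

Lemma approx_op n :
  agree n (approx n).1 (op2 \o e) /\ agree n (approx n).2 (op3 \o e).
Proof.
have [a2 a3] := approx_shift n; split=> m lt_m.
  exact: etrans (a2 m lt_m) (esym (lext_basis shift2 m)).
exact: etrans (a3 m lt_m) (esym (lext_basis shift3 m)).
Qed.

Lemma op2_step m : op2 (e m) = step2 p e op1 (op2 \o e) (op3 \o e) m.
Proof.
have [a2 a3] := approx_op (deg m).
rewrite -(step2_agree p e op1 a2 a3 (ltnSn _)) -approxS2.
exact: (lext_basis shift2 m).
Qed.

(** The right side sees [op2] and [op3] on basis vectors of degree below deg m, where stage deg m is
    exact. Only in the role of T is [op2] used up to degree deg m, whence the later stage for
    [aT]. *)
Lemma op3_step m : op3 (e m) = step3 p e op1 op2 (op2 \o e) (op3 \o e) m.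
Proof.
have [a2 a3] := approx_op (deg m); have [_ b3] := approx_bounded (deg m).
have [/agree_lext aT _] := approx_shift (deg m).+1.
rewrite -(step3_agree p op1 b3 a2 a3 aT (ltnSn _)) -approxS3.
exact: (lext_basis shift3 m).
Qed.

(** The first two relations at (i, j, k) are the clauses of the recursion at (i+1, j, k); the third
    at (0, j, k) is the clause at (0, j+1, k). [overlap] then carries the third from i to i+1, as
    the conditions kill its other terms. *)
Lemma step_rep (X1 X2 X3 : {linear V -> V}) :
  consistent p ->
  (forall i j k, X1 (e (i, j, k)) = e (i.+1, j, k)) ->
  X2 \o e =1 step2 p e X1 (X2 \o e) (X3 \o e) ->
  X3 \o e =1 step3 p e X1 X2 (X2 \o e) (X3 \o e) ->
  skew_rep p X1 X2 X3.
Proof.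
move=> con_p X1e X2e X3e.
have r21 v : defect21 p X1 X2 X3 v = 0.
  apply: eq0_on_basis v => -[[i j] k]; apply/defect_eq0.
  by rewrite X1e [LHS](X2e (i.+1, j, k)).
have r31 v : defect31 p X1 X2 X3 v = 0.
  apply: eq0_on_basis v => -[[i j] k]; apply/defect_eq0.
  by rewrite X1e [LHS](X3e (i.+1, j, k)).
split; [exact: r21 | exact: r31 | move=> v].
apply: eq0_on_basis v => -[[i j] k].
rewrite -[LHS]/(defect32 p X1 X2 X3 (e (i, j, k))); elim: i => [|i IHi].
  apply/defect_eq0; rewrite X1e.
  by rewrite (X2e (0, j, k)%N : X2 (e (0, j, k)%N) = _) [LHS](X3e (0, j.+1, k)%N).
rewrite -X1e.
have := overlap (e (i, j, k)) r21 r31.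
rewrite {}IHi linear0.
move: con_p; rewrite /consistent.
case: p => q1 q2 q3 a b c alpha beta gamma lambda mu nu b1 b2 b3.
case=> [[-> -> -> -> ->] -> -> -> [-> ->]].
by rewrite !subrr !mulr0 !scaler0 !scale0r oppr0 !addr0.
Qed.

(** The ordered monomials therefore send a single vector to distinct basis vectors, which gives
    independence. *)
Lemma step_monomial (X1 X2 X3 : {linear V -> V}) :
  (forall i j k, X1 (e (i, j, k)) = e (i.+1, j, k)) ->
  X2 \o e =1 step2 p e X1 (X2 \o e) (X3 \o e) ->
  X3 \o e =1 step3 p e X1 X2 (X2 \o e) (X3 \o e) ->
  ordered_monomial X1 X2 X3 (e (0, 0, 0)%N) =1 e.
Proof.
move=> X1e X2e X3e [[i j] k] /=.
have -> : iter k X3 (e (0, 0, 0)%N) = e (0, 0, k)%N.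
  by elim: k => //= k ->; exact: (X3e (0, 0, k)%N).
have -> : iter j X2 (e (0, 0, k)%N) = e (0, j, k)%N.
  by elim: j => //= j ->; exact: (X2e (0, j, k)%N).
by elim: i => //= i ->; rewrite X1e.
Qed.

Lemma pbw_rep : consistent p -> exists X1 X2 X3 : {linear V -> V},
  skew_rep p X1 X2 X3 /\ ordered_monomial X1 X2 X3 (e (0, 0, 0)%N) =1 e.
Proof.
move=> con_p; exists op1, op2, op3; split.
  exact: step_rep con_p op1E op2_step op3_step.
exact: step_monomial op1E op2_step op3_step.
Qed.

End Construction.

(** * The presented algebra *)

Section WordAction.
Variables (K : fieldType) (n : nat) (W : lmodType K).
Variable X : 'I_n -> {linear W -> W}.
Local Notation F := (free_alg K n).
Implicit Types (f g : F) (s : seq 'I_n).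

Definition word_act s w : W := foldr (fun i => X i) w s.

Lemma word_act_is_linear s : linear (word_act s).
Proof. by rewrite /word_act; elim: s => //= i s IHs k u v; rewrite IHs linearP. Qed.

HB.instance Definition _ s :=
  GRing.isLinear.Build K W W *:%R (word_act s) (word_act_is_linear s).

Definition free_act f w : W := lext (fun u : {fmonom 'I_n} => word_act u w) f.

Lemma free_actB f g w : free_act (f - g) w = free_act f w - free_act g w.
Proof. exact: linearB. Qed.

Lemma free_actZ k f w : free_act (k *: f) w = k *: free_act f w.
Proof. exact: linearZ_LR. Qed.

Lemma free_actU (u : {fmonom 'I_n}) w : free_act << u >> w = word_act u w.
Proof. exact: lextU. Qed.

Lemma free_act1 w : free_act 1 w = w.
Proof. by rewrite free_actU fm1. Qed.

Lemma free_act_var i w : free_act (free_var K i) w = X i w.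
Proof. by rewrite free_var.unlock free_actU fmU. Qed.

Lemma free_actM f g w : free_act (f * g) w = free_act f (free_act g w).
Proof.
rewrite malgME /free_act linear_sum; apply: eq_bigr => u _.
rewrite /lext !linear_sum; apply: eq_bigr => v _.
rewrite -[LHS]/(free_act _ w) malgUZ free_actZ free_actU linearZ /= scalerA.
by rewrite fmM /word_act foldr_cat.
Qed.

Lemma free_act0l w : free_act 0 w = 0.
Proof. exact: linear0. Qed.

Lemma free_act0r f : free_act f 0 = 0.
Proof.
by rewrite /free_act /lext big1 // => u _; rewrite linear0 scaler0.
Qed.

(** The annihilator of the module is a two-sided ideal, and it is the J chosen here. *)
Lemma free_act_ideal (rels : seq F) f :
  (forall r, r \in rels -> forall w, free_act r w = 0) ->
  f \in ideal_gen rels -> forall w, free_act f w = 0.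
Proof.
move=> rels0 /asboolP; move/(_ (fun g => forall w, free_act g w = 0)); apply=> //.
split=> [w|g h g0 h0 w|u g v g0 w].
- exact: free_act0l.
- by rewrite free_actB g0 h0 subrr.
- by rewrite !free_actM g0 free_act0r.
Qed.

End WordAction.

Section LeftMultiplication.
Variables (K : fieldType) (n : nat) (rels : seq (free_alg K n)).
Local Notation A := (pres_alg rels).

Definition lmul (x y : A) : A := x * y.

Lemma lmul_is_linear x : linear (lmul x).
Proof. by move=> k u v; rewrite /lmul mulrDr pres_scalerAr. Qed.

HB.instance Definition _ x :=
  GRing.isLinear.Build K A A *:%R (lmul x) (lmul_is_linear x).

Definition gen_op (i : 'I_n) : {linear A -> A} := lmul (pres_gen rels i).

Lemma pres_pi_word (u : {fmonom 'I_n}) (y : A) :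
  pres_pi rels << u >> * y = word_act gen_op u y.
Proof.
case: u => s; elim: s => [|i s IHs].
  have -> : FMonom [::] = mone :> {fmonom 'I_n} by apply/eqP; rewrite fmP fm1.
  by rewrite -[<< _ >>]/(1 : free_alg K n) rmorph1 mul1r fm1.
have -> : << FMonom (i :: s) >> = free_var K i * << FMonom s >> :> free_alg K n.
  rewrite free_var.unlock malgM_def fgmulUU mulr1; congr << _ >>.
  by apply/eqP; rewrite fmP fmM fmU.
by rewrite rmorphM -mulrA IHs.
Qed.

(** At y = 1 this turns statements on classes in the algebra into statements on the action. *)
Lemma pres_pi_act f (y : A) : pres_pi rels f * y = free_act gen_op f y.
Proof.
rewrite {1}[f]malg_sum_scale linear_sum mulr_suml; apply: eq_bigr => u _.
by rewrite linearZ -pres_scalerAl pres_pi_word.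
Qed.

End LeftMultiplication.

Lemma in_seq3 (T : eqType) (P : T -> Prop) (x y z : T) :
  (forall u, u \in [:: x; y; z] -> P u) <-> [/\ P x, P y & P z].
Proof.
split=> [inP | [Px Py Pz] u].
  by split; apply: inP; rewrite !inE eqxx ?orbT.
by rewrite !inE => /or3P[] /eqP ->.
Qed.

Lemma linear10 (K : fieldType) (U W : lmodType K) (h : {linear U -> W})
    (k1 k2 k3 k4 k5 k6 k7 k8 k9 k10 : K) v1 v2 v3 v4 v5 v6 v7 v8 v9 v10 :
  h (- (k1 *: v1) + k2 *: v2 + k3 *: v3 + k4 *: v4 + k5 *: v5 + k6 *: v6
     + k7 *: v7 + k8 *: v8 + k9 *: v9 + k10 *: v10) =
  - (k1 *: h v1) + k2 *: h v2 + k3 *: h v3 + k4 *: h v4 + k5 *: h v5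
  + k6 *: h v6 + k7 *: h v7 + k8 *: h v8 + k9 *: h v9 + k10 *: h v10.
Proof. by rewrite !(linearD, linearN, linearZ). Qed.

(** * Independence of the monomials forces the conditions *)

Section Freeness.
Variables (K : fieldType) (W : lmodType K) (p : params K).
Variables (X1 X2 X3 : {linear W -> W}) (w : W).
Local Notation e := (ordered_monomial X1 X2 X3 w).
Hypothesis free_mon : forall g, lext e g = 0 -> g = 0.

Lemma free_quadratic (k1 k2 k3 k4 k5 k6 k7 k8 k9 k10 : K) :
  - (k1 *: X1 (X1 w)) + k2 *: X1 (X2 w) + k3 *: X1 (X3 w) + k4 *: X2 (X2 w)
  + k5 *: X2 (X3 w) + k6 *: X3 (X3 w) + k7 *: X1 w + k8 *: X2 w + k9 *: X3 w
  + k10 *: w = 0 ->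
  [/\ [/\ k1 = 0, k2 = 0, k3 = 0, k4 = 0 & k5 = 0], k6 = 0, k7 = 0, k8 = 0
    & k9 = 0 /\ k10 = 0].
Proof.
pose g : {malg K[mon]} :=
  - (k1 *: << (2, 0, 0)%N >>) + k2 *: << (1, 1, 0)%N >> + k3 *: << (1, 0, 1)%N >>
  + k4 *: << (0, 2, 0)%N >> + k5 *: << (0, 1, 1)%N >> + k6 *: << (0, 0, 2)%N >>
  + k7 *: << (1, 0, 0)%N >> + k8 *: << (0, 1, 0)%N >> + k9 *: << (0, 0, 1)%N >>
  + k10 *: << (0, 0, 0)%N >>.
move=> comb0; have {comb0}/free_mon g0 : lext e g = 0.
  pose h : {linear {malg K[mon]} -> W} := lext e.
  have hE m : h << m >> = e m := lextU e m.
  by rewrite -[LHS]/(h g) /g linear10 !hE.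
(* Since g vanishes, so does the image of g under every linear functional d; the indicator functions
   of the ten exponents then isolate the coefficients. *)
have coef (d : mon -> K^o) :
    - (k1 * d (2, 0, 0)%N) + k2 * d (1, 1, 0)%N + k3 * d (1, 0, 1)%N
    + k4 * d (0, 2, 0)%N + k5 * d (0, 1, 1)%N + k6 * d (0, 0, 2)%N
    + k7 * d (1, 0, 0)%N + k8 * d (0, 1, 0)%N + k9 * d (0, 0, 1)%N
    + k10 * d (0, 0, 0)%N = 0.
  pose h : {linear {malg K[mon]} -> K^o} := lext d.
  have hE m : h << m >> = d m := lextU d m.
  by rewrite -!hE -[LHS]linear10 -/g g0 linear0.
have at_mon m := coef (fun n => (n == m)%:R).
have := (at_mon (2, 0, 0)%N, at_mon (1, 1, 0)%N, at_mon (1, 0, 1)%N,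
  at_mon (0, 2, 0)%N, at_mon (0, 1, 1)%N, at_mon (0, 0, 2)%N).
have := (at_mon (1, 0, 0)%N, at_mon (0, 1, 0)%N, at_mon (0, 0, 1)%N,
  at_mon (0, 0, 0)%N).
rewrite /= !mulr0 !mulr1 !(oppr0, addr0, add0r).
move=> [[[h7 h8] h9] h10] [[[[[/eqP h1 h2] h3] h4] h5] h6].
by rewrite oppr_eq0 in h1; move/eqP: h1.
Qed.

Lemma free_consistent : admissible p -> skew_rep p X1 X2 X3 -> consistent p.
Proof.
move=> + [r21 r31 r32]; have := overlap w r21 r31.
rewrite !r32 linear0 /admissible /consistent.
case: p => q1 q2 q3 a b c alpha beta gamma lambda mu nu b1 b2 b3 /=.
rewrite !scaler0 addr0 add0r => /esym/free_quadratic.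
(* Numbered as in [consistent]. Here [h1], [h2], [h3] still carry the factors q1, q2, q3, which are
   invertible. *)
move=> [[h4 h1 h2 h5 h3] h6 h7 h8 [h9 h10]] /and3P[q1_neq0 q2_neq0 q3_neq0].
have cancel (k x y : K) : k != 0 -> k * (x - y) = 0 -> x = y.
  by move=> /negPf k0 /eqP; rewrite mulf_eq0 k0 subr_eq0 => /eqP.
by split; [split; [apply: cancel h1 | apply: cancel h2 | apply: cancel h3 | |] | | | |].
Qed.

End Freeness.

(** * Representations of the presented algebra and its ordered monomials *)

Section Presentation.
Variables (K : fieldType) (p : params K).

Definition rels_of : seq (free_alg K 3) :=
  skew_rels (pq1 p) (pq2 p) (pq3 p) (pa p) (pb p) (pc p) (palpha p) (pbeta p)
    (pgamma p) (plambda p) (pmu p) (pnu p) (pb1 p) (pb2 p) (pb3 p).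

Section Representation.
Variables (W : lmodType K) (X : 'I_3 -> {linear W -> W}).

Lemma linear_relation (U : lmodType K) (h : {linear U -> W})
    (q a b c d : K) (f g u1 u2 u3 u4 : U) :
  h ((f - q *: g) - (a *: u1 + b *: u2 + c *: u3 + d *: u4)) =
  h f - q *: h g - (a *: h u1 + b *: h u2 + c *: h u3 + d *: h u4).
Proof. by rewrite !(linearB, linearD, linearZ). Qed.

Lemma free_act_var2 i j w :
  free_act X (free_var K i * free_var K j) w = X i (X j w).
Proof. by rewrite free_actM !free_act_var. Qed.

Lemma free_act_defect (q a b c d : K) (i j : 'I_3) w :
  let x := @free_var K 3 in
  free_act X ((x i * x j - q *: (x j * x i))
              - (a *: x i1 + b *: x i2 + c *: x i3 + d *: 1)) w
  = defect q a b c d (X i) (X j) (X i1) (X i2) (X i3) w.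
Proof.
move=> x; rewrite /defect -!free_act_var2 -!(free_act_var X).
have -> : d *: w = d *: free_act X 1 w by rewrite free_act1.
exact: linear_relation.
Qed.

Lemma skew_repP : skew_rep p (X i1) (X i2) (X i3) <->
  (forall r, r \in rels_of -> forall w, free_act X r w = 0).
Proof.
rewrite in_seq3 /skew_rep /defect21 /defect31 /defect32.
split=> [[r21 r31 r32] | [r21 r31 r32]].
  by split=> w; rewrite free_act_defect.
by split=> w; rewrite -free_act_defect; [apply: r21 | apply: r31 | apply: r32].
Qed.

Definition mon_word (s1 s2 s3 : 'I_3) (m : mon) : {fmonom 'I_3} :=
  let: (i, j, k) := m in FMonom (nseq i s1 ++ nseq j s2 ++ nseq k s3).

Lemma word_act_mon s1 s2 s3 (m : mon) w :
  word_act X (mon_word s1 s2 s3 m) w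
  = ordered_monomial (X s1) (X s2) (X s3) w m.
Proof.
have act_nseq i n u : foldr (fun i => X i) u (nseq n i) = iter n (X i) u.
  by elim: n => //= n ->.
by case: m => [[i j] k]; rewrite /word_act /= !foldr_cat !act_nseq.
Qed.

End Representation.

Local Notation A := (pres_alg rels_of).
Local Notation L := (gen_op rels_of).

Lemma gen_op_rep : skew_rep p (L i1) (L i2) (L i3).
Proof.
apply/skew_repP => r r_rel w.
by rewrite -pres_pi_act pres_relP // mul0r.
Qed.

(** A linear relation between monomials of the algebra lifts to an element f of the ideal of
    relations, and f acts by zero in every representation. *)
Lemma lext_monomial_transfer (W : lmodType K) (X : 'I_3 -> {linear W -> W}) w
    s1 s2 s3 (g : {malg K[mon]}) :
  skew_rep p (X i1) (X i2) (X i3) ->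
  lext (ordered_monomial (L s1) (L s2) (L s3) 1) g = 0 ->
  lext (ordered_monomial (X s1) (X s2) (X s3) w) g = 0.
Proof.
move=> /skew_repP rep.
pose f : free_alg K 3 := lext (fun m => << mon_word s1 s2 s3 m >>) g.
have actf (U : lmodType K) (Y : 'I_3 -> {linear U -> U}) u :
    free_act Y f u = lext (ordered_monomial (Y s1) (Y s2) (Y s3) u) g.
  rewrite /free_act /f lext_comp; apply: eq_lext => m.
  by rewrite -word_act_mon -free_actU.
rewrite -!actf -pres_pi_act mulr1 => f0.
apply: (free_act_ideal rep).
by rewrite -[f]subr0; apply/pres_piP; rewrite f0 raddf0.
Qed.

(** The span contains 1 and is stable under every generator, because s is surjective; by induction
    on words it is everything. *)
Lemma ordered_monomial_spanned (s : 'S_3) p' v :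
  skew_rep p' (L (s i1)) (L (s i2)) (L (s i3)) ->
  spanned predT (ordered_monomial (L (s i1)) (L (s i2)) (L (s i3)) 1) v.
Proof.
move=> rep; set e := ordered_monomial _ _ _ _.
have stable i w : spanned predT e w -> spanned predT e (L i w).
  move=> /(ordered_monomial_stable rep)[st1 st2 st3].
  rewrite -[i](permKV s); case: (s^-1%g i) => [[|[|[|//]]] lt_i].
  - by rewrite (_ : Ordinal lt_i = i1) //; apply: val_inj.
  - by rewrite (_ : Ordinal lt_i = i2) //; apply: val_inj.
  by rewrite (_ : Ordinal lt_i = i3) //; apply: val_inj.
rewrite -[v]pres_reprK -[pres_pi _ _]mulr1 pres_pi_act.
rewrite /free_act /lext; apply: big_ind => [|u w|u _].
- exact: spanned0.
- exact: spannedD.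
apply: spannedZ; case: u => u; elim: u => [|i u IHu] /=; last exact: stable.
exact: (@spannedU _ _ _ predT e (0, 0, 0)%N).
Qed.

Lemma spanned_lext (W : lmodType K) (e : mon -> W) w :
  spanned predT e w -> exists g, w = lext e g.
Proof.
elim=> [|k m v _ _ [g ->]]; first by exists 0; rewrite linear0.
by exists (k *: << m >> + g); rewrite linearP /= lextU.
Qed.

Lemma consistent_is_basis (s : 'S_3) : admissible p -> consistent p ->
  is_basis (ordered_monomial (L (s i1)) (L (s i2)) (L (s i3)) 1).
Proof.
move=> adm_p con_p.
have [p' con_p' repE] := permuted_params s adm_p con_p.
apply/is_basisP; split=> [v | g].
  apply: spanned_lext; apply: (ordered_monomial_spanned (p' := p')).
  exact/repE/gen_op_rep.
have [X1 [X2 [X3 [rep' monE]]]] := pbw_rep con_p'.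
(* Chosen so that [X (s i1)], [X (s i2)], [X (s i3)] are X1, X2, X3. *)
pose X i := if (s^-1)%g i == i1 then X1 else if (s^-1)%g i == i2 then X2 else X3.
have /(_ _ X) /proj2 repX := repE.
have {}repX : skew_rep p (X i1) (X i2) (X i3) by apply: repX; rewrite /X !permK.
move=> /(lext_monomial_transfer (basis_vec K (0, 0, 0)%N) repX).
(* In this module the monomials are the basis vectors, so the combination with coefficients g is g
   itself. *)
rewrite /X !permK /= (eq_lext monE) => g0.
by rewrite [g]malg_sum_scale.
Qed.

Lemma is_basis_consistent : admissible p ->
  is_basis (ordered_monomial (L i1) (L i2) (L i3) 1) -> consistent p.
Proof.
move=> adm_p /is_basisP[_ free_mon].
exact: free_consistent free_mon adm_p gen_op_rep.
Qed.

End Presentation.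

(** * From exponent functions to exponent triples *)

Section Monomials.
Variables (K : fieldType) (rels : seq (free_alg K 3)) (s : 'I_3 -> 'I_3).
Local Notation A := (pres_alg rels).
Local Notation L := (gen_op rels).

Definition exponents (m : {ffun 'I_3 -> nat}) : mon := (m i1, m i2, m i3).

Definition of_exponents (m : mon) : {ffun 'I_3 -> nat} :=
  [ffun i : 'I_3 => nth 0%N [:: m.1.1; m.1.2; m.2] i].

Lemma exponentsK : cancel exponents of_exponents.
Proof.
move=> m; apply/ffunP => i; rewrite ffunE.
by case: i => [[|[|[|//]]] lt_i] /=; congr (m _); apply: val_inj.
Qed.

Lemma of_exponentsK : cancel of_exponents exponents.
Proof. by case=> [[i j] k]; rewrite /exponents !ffunE. Qed.

Lemma mon3E (m : {ffun 'I_3 -> nat}) :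
  mon3 (fun i => pres_gen rels (s i)) m =
  ordered_monomial (L (s i1)) (L (s i2)) (L (s i3)) 1 (exponents m).
Proof.
have iterL i n (y : A) : iter n (L i) y = pres_gen rels i ^+ n * y.
  by elim: n => [|n IHn]; rewrite ?mul1r //= IHn exprS -mulrA.
by rewrite /ordered_monomial /= !iterL mulr1 /mon3 mulrA.
Qed.

Lemma is_basis_mon3 : is_basis (mon3 (fun i => pres_gen rels (s i))) <->
  is_basis (ordered_monomial (L (s i1)) (L (s i2)) (L (s i3)) 1).
Proof.
set b := ordered_monomial _ _ _ _.
have -> : mon3 (fun i => pres_gen rels (s i)) = b \o exponents.
  by apply/funext => m; exact: mon3E.
split=> bas; last exact: is_basis_reindex exponentsK of_exponentsK bas.
have := is_basis_reindex of_exponentsK exponentsK bas.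
rewrite (_ : (b \o exponents) \o of_exponents = b) //.
by apply/funext => m; rewrite /comp of_exponentsK.
Qed.

End Monomials.

Theorem theorem1p3 (K : fieldType)
    (q1 q2 q3 a b c alpha beta gamma lambda mu nu b1 b2 b3 : K)
    (hq1 : q1 != 0) (hq2 : q2 != 0) (hq3 : q3 != 0) :
  let A := pres_alg (skew_rels q1 q2 q3 a b c alpha beta gamma lambda mu nu
                       b1 b2 b3) in
  let x : 'I_3 -> A := pres_gen _ in
  ((exists u : A, u != 0) /\ is_basis (mon3 x) <->
      (1 - q3) * alpha = (1 - q2) * mu
   /\ (1 - q3) * a = (1 - q1) * nu
   /\ (1 - q2) * b = (1 - q1) * gamma
   /\ (1 - q1 * q2) * lambda = 0
   /\ (q1 - q3) * beta = 0
   /\ (1 - q2 * q3) * c = 0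
   /\ ((1 - q3) * alpha - mu) * a + (b + q1 * gamma) * lambda - nu * alpha
        + (q1 * q2 - 1) * b3 = 0
   /\ (a - nu) * beta + q1 * gamma * mu - q3 * alpha * b + (q1 - q3) * b2 = 0
   /\ (a + (q1 - 1) * nu) * gamma + b * nu - (mu + q3 * alpha) * c
        + (1 - q2 * q3) * b1 = 0
   /\ - (mu + q3 * alpha) * b1 + (a - nu) * b2 + (b + q1 * gamma) * b3 = 0)
  /\ (is_basis (mon3 x) ->
        forall s : 'S_3, is_basis (mon3 (fun i => x (s i)))).
Proof.
pose p := Params q1 q2 q3 a b c alpha beta gamma lambda mu nu b1 b2 b3.
have adm_p : admissible p by rewrite /admissible hq1 hq2.
move=> A x.
have basis_con : is_basis (mon3 x) -> consistent p.
  by move/(is_basis_mon3 (rels_of p) id)/(is_basis_consistent adm_p).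
have con_basis (s : 'S_3) : consistent p -> is_basis (mon3 (fun i => x (s i))).
  move=> con_p; apply/(is_basis_mon3 (rels_of p) s).
  exact: consistent_is_basis.
split=> [|/basis_con con_p s]; last exact: con_basis.
split=> [[_ /basis_con] | [h1 [h2 [h3 [h4 [h5 [h6 [h7 [h8 [h9 h10]]]]]]]]]].
  by case=> [[-> -> -> -> ->] -> -> -> [-> ->]].
have con_p : consistent p by split; [split | | | |].
have bas : is_basis (mon3 x).
  have := con_basis 1%g con_p; rewrite (_ : (fun i => x ((1%g : 'S_3) i)) = x) //.
  by apply/funext => i; rewrite perm1.
(* 1 is the monomial of exponent 0, hence a member of the basis: were it zero, the coefficient 1 of
   [<< m0 >>] would vanish in K. *)
split=> //; exists 1.
have [_ free] := (is_basisP _).1 bas.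
pose m0 : {ffun 'I_3 -> nat} := [ffun=> 0%N].
have mon1 : mon3 x m0 = 1 by rewrite /mon3 !ffunE !expr0 !mulr1.
apply/negP => /eqP one0.
have /free/malgP/(_ m0) : lext (mon3 x) << m0 >> = 0 by rewrite lextU mon1.
by rewrite mcoeffUU mcoeff0 => /eqP; rewrite oner_eq0.
Qed.
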